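(* Let $\Gamma$ be a groupoid and $R$ a $\Gamma$-graded ring. Let $I,J$ be non-empty sets, $\{M_j:j\in J\}$ and $\{N_i:i\in I\}$ families of $\Gamma$-graded $R$-modules, $M=\bigoplus_{j\in J}M_j$ and $N=\bigoplus_{i\in I}N_i$. Suppose that, for all $j\in J$ and all homogeneous $g\in\mathrm{HOM}(M_j,N)$, there exists a finite $I_g\subseteq I$ such that $\operatorname{im}g\subseteq\bigoplus_{i\in I_g}N_i$. Consider the natural inclusions $\rho_j:M_j\to M$, $\rho_i':N_i\to N$ and the natural projections $\pi_j:M\to M_j$, $\pi_i':N\to N_i$ for all $i\in I$, $j\in J$. The following statements hold true. (1) The natural map $\mathrm{HOM}(M,N)\to\mathbb{H}_{I\times J}(M,N)$, $f\mapsto(\pi_i'f\rho_j)_{ij}$, is a gr-isomorphism of $\Gamma$-graded additive groups. (2) The natural map $\mathrm{END}(M)\to\mathbb{H}_{J\times J}(M,M)$, $f\mapsto(\pi_if\rho_j)_{ij}$, is a gr-isomorphism of $\Gamma$-graded rings. (3) If, moreover, for all $e\in\Gamma_0$ there exists a finite $J_e\subseteq J$ such that $M(e)=\bigoplus_{j\in J_e}M_j(e)$, then $\mathbb{H}_{I\times J}(M,N)$ consists of matrices with only a finite number of nonzero entries.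
   Context: A groupoid $\Gamma$ is a small category with all morphisms invertible, identified with its set of morphisms; $\Gamma_0$ is its set of objects (identified with identity morphisms). For $\gamma:e\to f$ write $d(\gamma)=e$, $r(\gamma)=f$; $\delta\gamma$ is defined iff $d(\delta)=r(\gamma)$. A $\Gamma$-graded ring is an associative ring $R=\bigoplus_{\gamma\in\Gamma}R_\gamma$ (additive subgroups) with $R_\gamma R_\delta\subseteq R_{\gamma\delta}$ if $\gamma\delta$ is defined and $R_\gamma R_\delta=0$ otherwise, assumed object unital: for each $e\in\Gamma_0$, $R_e$ is a unital ring with identity $1_e$ (possibly $1_e=0$) and $1_{r(\gamma)}a=a=a1_{d(\gamma)}$ for $a\in R_\gamma$. A $\Gamma$-graded $R$-module is a right $R$-module $M=\bigoplus_\gamma M_\gamma$ with $M_\gamma R_\delta\subseteq M_{\gamma\delta}$ (zero if undefined) and $MR=M$; $M(e)=\bigoplus_{r(\gamma)=e}M_\gamma$ for $e\in\Gamma_0$. Direct sums are graded by $(\bigoplus_jM_j)_\gamma=\bigoplus_j(M_j)_\gamma$. $\mathrm{HOM}(M,N)=\bigoplus_\gamma\mathrm{HOM}(M,N)_\gamma$, where $\mathrm{HOM}(M,N)_\gamma$ is the group of $R$-module homomorphisms $g:M\to N$ with $g(M_\sigma)\subseteq N_{\gamma\sigma}$ for all $\sigma$ ($N_{\gamma\sigma}=0$ if $\gamma\sigma$ is undefined). $\mathrm{END}(M)=\mathrm{HOM}(M,M)$ is a $\Gamma$-graded ring under composition. A homogeneous element of $\mathrm{HOM}(M,N)$ is an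 element of some $\mathrm{HOM}(M,N)_\gamma$. A gr-isomorphism is a degree-preserving isomorphism. For decomposed modules $M=\bigoplus_{j\in J}M_j$, $N=\bigoplus_{i\in I}N_i$ and $\gamma\in\Gamma$, $\mathbb{H}_{I\times J}(M,N)_\gamma$ is the additive group of $I\times J$ column finite matrices $(f_{ij})$ with $f_{ij}\in\mathrm{HOM}(M_j,N_i)_\gamma$, and $\mathbb{H}_{I\times J}(M,N)=\bigoplus_\gamma\mathbb{H}_{I\times J}(M,N)_\gamma$. $\mathbb{H}_{J\times J}(M,M)$ (formed with the decomposition $M=\bigoplus_{j\in J}M_j$ on both sides) is a $\Gamma$-graded ring with matrix multiplication.
   Formalization: Statement (2) is proved under the added assumption that every homogeneous g in HOM(M_j, M) has image in a finite subsum of the M_i; the stated hypothesis concerns only maps M_j → N, and (2) is false without the addition (e.g. when all N_i = 0). *)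

(* Defs.v *)
From HB Require Import structures.
From mathcomp Require Import all_boot all_algebra.
From mathcomp Require Import boolp classical_sets functions cardinality fsbigop.

Set Implicit Arguments.
Unset Strict Implicit.
Unset Printing Implicit Defensive.
Import GRing.Theory.
Local Open Scope classical_set_scope.
Local Open Scope ring_scope.
#[local] Obligation Tactic := idtac.

Section InternalSums.
Variables (A : zmodType) (I : choiceType).

Definition subgroup (S : set A) : Prop :=
  S 0 /\ forall a b, S a -> S b -> S (a - b).

Definition fsupp (x : I -> A) : Prop := finite_set [set i | x i != 0].

(* The sum over [P] of the subgroups [S i] of [A], as a subset of [A]. *)
Definition isum (P : set I) (S : I -> set A) : set A :=
  [set a | exists x : I -> A,
    [/\ forall i, S i (x i), fsupp x & a = \sum_(i \in P) x i]].

Definition direct_decomposition (S : I -> set A) : Prop :=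
  (forall i, subgroup (S i)) /\
  forall a, exists! x : I -> A,
    [/\ forall i, S i (x i), fsupp x & a = \sum_(i \in [set: I]) x i].

End InternalSums.

(* Groupoids, presented by their morphisms.  [gmul] is total, but its value
   [gmul g h] is meaningful only if [gdom g = gcod h]. *)

Record groupoid := Groupoid {
  gobj : choiceType;
  garr :> choiceType;
  gdom : garr -> gobj;
  gcod : garr -> gobj;
  gid : gobj -> garr;
  gmul : garr -> garr -> garr;
  ginv : garr -> garr;
  gdom_id : forall e, gdom (gid e) = e;
  gcod_id : forall e, gcod (gid e) = e;
  gdom_mul : forall g h, gdom g = gcod h -> gdom (gmul g h) = gdom h;
  gcod_mul : forall g h, gdom g = gcod h -> gcod (gmul g h) = gcod g;
  gmulA : forall g h k, gdom g = gcod h -> gdom h = gcod k ->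
    gmul g (gmul h k) = gmul (gmul g h) k;
  gmul1 : forall g, gmul g (gid (gdom g)) = g;
  gmul1l : forall g, gmul (gid (gcod g)) g = g;
  gdom_inv : forall g, gdom (ginv g) = gcod g;
  gcod_inv : forall g, gcod (ginv g) = gdom g;
  gmulV : forall g, gmul g (ginv g) = gid (gcod g);
  gmulVl : forall g, gmul (ginv g) g = gid (gdom g)
}.

Record grgroup (G : groupoid) := GrGroup {
  grcar :> zmodType;
  grdeg : G -> set grcar;
  grdegP : direct_decomposition grdeg
}.
Arguments grdeg {G} A g : rename.

(* The component of degree [g h] of [A], and [0] if [g h] is undefined. *)
Definition degprod (G : groupoid) (A : grgroup G) (g h : G) : set A :=
  if gdom g == gcod h then grdeg A (gmul g h) else [set 0].
Arguments degprod {G} A g h.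

(* The subgroup A(e), the sum of the A_g with r(g) = e. *)
Definition corner (G : groupoid) (A : grgroup G) (e : gobj G) : set A :=
  isum [set g | gcod g = e] (grdeg A).
Arguments corner {G} A e.

(* Object unital graded rings; there need not be a global identity. *)
Record grring (G : groupoid) := GrRing {
  rgrp :> grgroup G;
  rmul : rgrp -> rgrp -> rgrp;
  rone : gobj G -> rgrp;
  rmulA : forall a b c, rmul a (rmul b c) = rmul (rmul a b) c;
  rmulDl : forall a b c, rmul (a + b) c = rmul a c + rmul b c;
  rmulDr : forall a b c, rmul a (b + c) = rmul a b + rmul a c;
  rmul_deg : forall g h a b,
    grdeg rgrp g a -> grdeg rgrp h b -> degprod rgrp g h (rmul a b);
  rone_deg : forall e, grdeg rgrp (gid e) (rone e);
  rmul1l : forall g a, grdeg rgrp g a -> rmul (rone (gcod g)) a = a;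
  rmul1r : forall g a, grdeg rgrp g a -> rmul a (rone (gdom g)) = a
}.

(* Right graded modules; [mact_full] is the condition M R = M. *)
Record grmod (G : groupoid) (R : grring G) := GrMod {
  mgrp :> grgroup G;
  mact : mgrp -> R -> mgrp;
  mactA : forall m a b, mact m (rmul a b) = mact (mact m a) b;
  mactDl : forall m n a, mact (m + n) a = mact m a + mact n a;
  mactDr : forall m a b, mact m (a + b) = mact m a + mact m b;
  mact_deg : forall g h m a,
    grdeg mgrp g m -> grdeg R h a -> degprod mgrp g h (mact m a);
  mact_full : forall m, exists s : seq (mgrp * R),
    m = \sum_(p <- s) mact p.1 p.2
}.

Definition gr_iso (G : groupoid) (A B : grgroup G) (F : A -> B) : Prop :=
  [/\ {morph F : a b / a + b}, bijective F
    & forall g a, grdeg A g a -> grdeg B g (F a)].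

Definition gr_ring_iso (G : groupoid) (A B : grring G) (F : A -> B) : Prop :=
  gr_iso F /\ {morph F : a b / rmul a b}.

Section FiniteSums.
Variable I : choiceType.
Implicit Types A B : zmodType.

Lemma finite_seq_of (T : choiceType) (P : set T) : finite_set P ->
  exists2 r : seq T, uniq r & forall i, P i <-> i \in r.
Proof.
move=> /finite_seqP[r ->]; exists (undup r); first exact: undup_uniq.
by move=> i /=; rewrite mem_undup.
Qed.

Lemma fsumE A (r : seq I) (x : I -> A) : uniq r ->
  (forall i, i \notin r -> x i = 0) ->
  \sum_(i \in [set: I]) x i = \sum_(i <- r) x i.
Proof.
move=> ur x0; rewrite (@bigfs _ _ _ _ r predT) //; last by move=> i _; exact: x0.
by apply: eq_fsbigl; apply/seteqP.
Qed.

Lemma finsupp_seq A (x : I -> A) : fsupp x ->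
  exists2 r : seq I, uniq r & forall i, i \notin r -> x i = 0.
Proof.
move=> /finite_seq_of[r ur rP]; exists r => // i.
by apply: contraNeq => xi; apply/rP.
Qed.

Lemma seq_finsupp A (r : seq I) (x : I -> A) :
  (forall i, i \notin r -> x i = 0) -> fsupp x.
Proof.
move=> h; apply: (sub_finite_set _ (finite_seq r)) => i /=.
by apply: contra_neqT => /h.
Qed.

Lemma finsupp2_seq A B (x : I -> A) (y : I -> B) : fsupp x -> fsupp y ->
  exists r : seq I, [/\ uniq r, forall i, i \notin r -> x i = 0
    & forall i, i \notin r -> y i = 0].
Proof.
move=> /finsupp_seq[r ur rP] /finsupp_seq[s us sP].
exists (undup (r ++ s)); split; first exact: undup_uniq.
  by move=> i; rewrite mem_undup mem_cat negb_or => /andP[/rP].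
by move=> i; rewrite mem_undup mem_cat negb_or => /andP[_ /sP].
Qed.

Lemma finsupp0 A : fsupp (fun _ : I => 0 : A).
Proof. exact: (@seq_finsupp _ [::]). Qed.

Lemma finsuppD A (x y : I -> A) : fsupp x -> fsupp y ->
  fsupp (fun i => x i + y i).
Proof.
move=> fx fy; have [r [_ rx ry]] := finsupp2_seq fx fy.
by apply: (@seq_finsupp _ r) => i ir; rewrite rx ?ry ?addr0.
Qed.

Lemma finsuppN A (x : I -> A) : fsupp x -> fsupp (fun i => - x i).
Proof.
move=> /finsupp_seq[r _ rx].
by apply: (@seq_finsupp _ r) => i ir; rewrite rx ?oppr0.
Qed.

Lemma finsupp_map A B (f : A -> B) (x : I -> A) : f 0 = 0 ->
  fsupp x -> fsupp (fun i => f (x i)).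
Proof.
move=> f0 /finsupp_seq[r _ rx].
by apply: (@seq_finsupp _ r) => i ir; rewrite rx ?f0.
Qed.

Lemma fsumD A (x y : I -> A) : fsupp x -> fsupp y ->
  \sum_(i \in [set: I]) (x i + y i) =
  \sum_(i \in [set: I]) x i + \sum_(i \in [set: I]) y i.
Proof.
move=> fx fy; have [r [ur rx ry]] := finsupp2_seq fx fy.
rewrite !(fsumE ur) //; first by rewrite big_split.
by move=> i ir; rewrite rx ?ry ?addr0.
Qed.

Lemma fsum_map A B (f : A -> B) (x : I -> A) : f 0 = 0 ->
  {morph f : a b / a + b} -> fsupp x ->
  f (\sum_(i \in [set: I]) x i) = \sum_(i \in [set: I]) f (x i).
Proof.
move=> f0 fD /finsupp_seq[r ur rx].
rewrite !(fsumE ur) //; first exact: big_morph.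
by move=> i ir; rewrite rx ?f0.
Qed.

Lemma fsum1 A (x : I -> A) i : (forall j, j != i -> x j = 0) ->
  \sum_(j \in [set: I]) x j = x i.
Proof.
move=> h; rewrite (@fsumE _ [:: i]) ?big_seq1 // => j.
by rewrite inE; exact: h.
Qed.

Lemma fsum_eq A (x y : I -> A) : x =1 y ->
  \sum_(j \in [set: I]) x j = \sum_(j \in [set: I]) y j.
Proof. by move=> /funext ->. Qed.

Lemma fsum0 A : \sum_(j \in [set: I]) (0 : A) = 0.
Proof. exact: fsbig1. Qed.

Lemma fsum_closed A (P : A -> Prop) (x : I -> A) : P 0 ->
  (forall a b, P a -> P b -> P (a + b)) -> (forall i, P (x i)) ->
  P (\sum_(j \in [set: I]) x j).
Proof. by move=> P0 PD Px; apply: big_ind. Qed.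

Lemma subgroup0 A (S : set A) : subgroup S -> S 0. Proof. by case. Qed.
Lemma subgroupB A (S : set A) a b : subgroup S -> S a -> S b -> S (a - b).
Proof. by case=> _; apply. Qed.
Lemma subgroupN A (S : set A) a : subgroup S -> S a -> S (- a).
Proof. by move=> SS Sa; rewrite -sub0r; apply: subgroupB => //; case: SS. Qed.
Lemma subgroupD A (S : set A) a b : subgroup S -> S a -> S b -> S (a + b).
Proof. by move=> SS Sa Sb; rewrite -[b]opprK; apply: subgroupB => //; exact: subgroupN. Qed.

Lemma isum_homog A (S : I -> set A) i a :
  (forall i, subgroup (S i)) -> S i a -> isum [set: I] S a.
Proof.
move=> SS Sa; exists (fun j => if j == i then a else 0).
split; first by move=> j; case: eqP => [->//|_]; case: (SS j).
  by apply: (@seq_finsupp _ [:: i]) => j; rewrite inE => /negPf ->.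
rewrite (@fsum1 _ _ i) ?eqxx // => j /negPf ->; by [].
Qed.

Lemma isum_subgroup A (S : I -> set A) :
  (forall i, subgroup (S i)) -> subgroup (isum [set: I] S).
Proof.
move=> SS; split.
  exists (fun=> 0); split; [by move=> i; case: (SS i)|exact: finsupp0|].
  by rewrite fsum0.
move=> _ _ [x [Sx fx ->]] [y [Sy fy ->]].
exists (fun i => x i + - y i); split.
- by move=> i; apply: subgroupB.
- by apply: finsuppD => //; apply: finsuppN.
- rewrite fsumD //; last exact: finsuppN.
  by congr (_ + _); apply: (fsum_map (f := -%R)) => //; [exact: oppr0|exact: opprD].
Qed.

Lemma isum_ind A (S : I -> set A) (P : A -> Prop) : P 0 ->
  (forall a b, P a -> P b -> P (a + b)) ->
  (forall i a, S i a -> P a) -> forall a, isum [set: I] S a -> P a.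
Proof.
move=> P0 PD PS _ [x [Sx _ ->]].
by apply: fsum_closed => // i; apply: PS (Sx i).
Qed.

Lemma direct_decomposition_intro A (S : I -> set A) :
  (forall i, subgroup (S i)) -> (forall a, isum [set: I] S a) ->
  (forall x : I -> A, (forall i, S i (x i)) -> fsupp x ->
     \sum_(i \in [set: I]) x i = 0 -> forall i, x i = 0) ->
  direct_decomposition S.
Proof.
move=> SS Sa S0; split=> // a; have [x [Sx fx ax]] := Sa a.
exists x; split=> // y [Sy fy ay]; apply/funext => i; apply/eqP.
rewrite -subr_eq0; apply/eqP.
apply: (S0 (fun i => x i - y i)).
- by move=> j; apply: subgroupB.
- by apply: finsuppD => //; apply: finsuppN.
- rewrite fsumD //; last exact: finsuppN.
  rewrite -(fsum_map (f := -%R)) ?oppr0 //; last exact: opprD.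
  by rewrite -ax -ay subrr.
Qed.

End FiniteSums.

Section Components.
Variables (G : groupoid) (A : grgroup G).

Definition cpt (g : G) (a : A) : A := sval (cid ((grdegP A).2 a)) g.

Lemma cptP a : [/\ forall g, grdeg A g (cpt g a), fsupp (cpt ^~ a)
  & a = \sum_(g \in [set: G]) cpt g a].
Proof. by rewrite /cpt; case: cid => x []. Qed.

Lemma cpt_deg g a : grdeg A g (cpt g a).
Proof. by case: (cptP a). Qed.
Lemma cpt_supp a : fsupp (cpt ^~ a).
Proof. by case: (cptP a). Qed.
Lemma cpt_sum a : a = \sum_(g \in [set: G]) cpt g a.
Proof. by case: (cptP a). Qed.

Lemma cpt_uniq (x : G -> A) a : (forall g, grdeg A g (x g)) -> fsupp x ->
  a = \sum_(g \in [set: G]) x g -> forall g, cpt g a = x g.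
Proof.
by move=> Sx fx ax g; rewrite /cpt; case: cid => y /= [_ /(_ x)->].
Qed.

Lemma deg_sub g : subgroup (grdeg A g). Proof. exact: (grdegP A).1. Qed.
Lemma deg0 g : grdeg A g 0. Proof. exact: (deg_sub g).1. Qed.

Lemma cptD g : {morph cpt g : a b / a + b}.
Proof.
move=> a b; apply: (cpt_uniq (x := fun g => cpt g a + cpt g b)).
- by move=> h; apply: subgroupD (deg_sub h) _ _; exact: cpt_deg.
- by apply: finsuppD; exact: cpt_supp.
- by rewrite fsumD -?cpt_sum //; exact: cpt_supp.
Qed.

Lemma cpt0 g : cpt g 0 = 0.
Proof. by have := cptD g 0 0; rewrite addr0 => /eqP; rewrite -subr_eq subrr eq_sym => /eqP. Qed.

Lemma cpt_homog g h a : grdeg A g a -> cpt h a = if h == g then a else 0.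
Proof.
move=> Aa; apply: (cpt_uniq (x := fun h => if h == g then a else 0)).
- by move=> k; case: eqP => [->//|_]; exact: deg0.
- by apply: (@seq_finsupp _ _ [:: g]) => k; rewrite inE => /negPf ->.
- by rewrite (@fsum1 _ _ _ g) ?eqxx // => k /negPf ->.
Qed.

Lemma homog_ind (P : A -> Prop) : P 0 ->
  (forall a b, P a -> P b -> P (a + b)) ->
  (forall g a, grdeg A g a -> P a) -> forall a, P a.
Proof.
move=> P0 PD PS a; rewrite (cpt_sum a).
by apply: fsum_closed => // g; apply: PS; exact: cpt_deg.
Qed.

Definition cproj (e : gobj G) (a : A) : A :=
  \sum_(g \in [set g | gcod g = e]) cpt g a.

Lemma cprojE e a : cproj e a =
  \sum_(g \in [set: G]) (if gcod g == e then cpt g a else 0).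
Proof.
rewrite /cproj fsbig_mkcond; apply: fsum_eq => g; rewrite /patch.
by case: eqP => [ge|ge]; [rewrite mem_set|rewrite memNset].
Qed.

Lemma cproj_supp e a : fsupp (fun g => if gcod g == e then cpt g a else 0).
Proof.
have [r _ rP] := finsupp_seq (cpt_supp a).
by apply: (@seq_finsupp _ _ r) => i /rP ->; case: ifP.
Qed.

Lemma cprojD e : {morph cproj e : a b / a + b}.
Proof.
move=> a b; rewrite !cprojE -fsumD; try exact: cproj_supp.
by apply: fsum_eq => g; case: ifP => _; rewrite ?addr0 ?cptD.
Qed.

Lemma cproj0 e : cproj e 0 = 0.
Proof. by rewrite cprojE fsbig1 // => g _; rewrite cpt0; case: ifP. Qed.

Lemma cproj_homog e g a : grdeg A g a ->
  cproj e a = if gcod g == e then a else 0.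
Proof.
move=> Aa; rewrite cprojE (@fsum1 _ _ _ g).
  by rewrite (cpt_homog _ Aa) eqxx.
by move=> j jg; rewrite (cpt_homog _ Aa) (negPf jg); case: ifP.
Qed.

End Components.

Section RHom.
Variables (G : groupoid) (R : grring G).
Implicit Types M N : grmod R.

Record rhom M N := RHom {
  hfun :> M -> N;
  homD : {morph hfun : m n / m + n};
  homM : forall m (a : R), hfun (mact m a) = mact (hfun m) a
}.

Lemma homP M N (f f' : rhom M N) : f =1 f' -> f = f'.
Proof.
case: f f' => [f p q] [f' p' q'] /= /funext e; move: p' q'; rewrite -e => p' q'.
by congr RHom; exact: Prop_irrelevance.
Qed.

HB.instance Definition _ M N := gen_eqMixin (rhom M N).
HB.instance Definition _ M N := gen_choiceMixin (rhom M N).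

Lemma mact0l M a : mact (0 : M) a = 0.
Proof.
have := mactDl (0 : M) 0 a; rewrite addr0 => /eqP.
by rewrite -subr_eq subrr eq_sym => /eqP.
Qed.

Lemma mact0r M (m : M) : mact m 0 = 0.
Proof.
have := mactDr m 0 0; rewrite addr0 => /eqP.
by rewrite -subr_eq subrr eq_sym => /eqP.
Qed.

Lemma mactNl M (m : M) a : mact (- m) a = - mact m a.
Proof. by apply/eqP; rewrite -addr_eq0 -mactDl addNr mact0l. Qed.

Program Definition hom_zero M N : rhom M N := @RHom M N (fun=> 0) _ _.
Next Obligation. by move=> M N m n /=; rewrite addr0. Qed.
Next Obligation. by move=> M N m a /=; rewrite mact0l. Qed.

Program Definition hom_opp M N (f : rhom M N) : rhom M N :=
  @RHom M N (fun m => - f m) _ _.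
Next Obligation. by move=> M N f m n /=; rewrite homD opprD. Qed.
Next Obligation. by move=> M N f m a /=; rewrite homM mactNl. Qed.

Program Definition hom_add M N (f f' : rhom M N) : rhom M N :=
  @RHom M N (fun m => f m + f' m) _ _.
Next Obligation. by move=> M N f f' m n /=; rewrite !homD addrACA. Qed.
Next Obligation. by move=> M N f f' m a /=; rewrite !homM mactDl. Qed.

Fact hom_addA M N : associative (@hom_add M N).
Proof. by move=> f g h; apply: homP => m /=; rewrite addrA. Qed.
Fact hom_addC M N : commutative (@hom_add M N).
Proof. by move=> f g; apply: homP => m /=; rewrite addrC. Qed.
Fact hom_add0 M N : left_id (hom_zero M N) (@hom_add M N).
Proof. by move=> f; apply: homP => m /=; rewrite add0r. Qed.
Fact hom_addN M N : left_inverse (hom_zero M N) (@hom_opp M N) (@hom_add M N).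
Proof. by move=> f; apply: homP => m /=; rewrite addNr. Qed.

HB.instance Definition _ M N := GRing.isZmodule.Build (rhom M N)
  (@hom_addA M N) (@hom_addC M N) (@hom_add0 M N) (@hom_addN M N).

Lemma hom_addE M N (f f' : rhom M N) m : (f + f') m = f m + f' m.
Proof. by []. Qed.
Lemma hom_oppE M N (f : rhom M N) m : (- f) m = - f m.
Proof. by []. Qed.
Lemma hom_zeroE M N m : (0 : rhom M N) m = 0.
Proof. by []. Qed.

Lemma hom0 M N (f : rhom M N) : f 0 = 0.
Proof. by have := homD f 0 0; rewrite addr0 => /eqP; rewrite -subr_eq subrr eq_sym => /eqP. Qed.

Program Definition hcomp M N P (f : rhom N P) (g : rhom M N) : rhom M P :=
  @RHom M P (fun m => f (g m)) _ _.
Next Obligation. by move=> M N P f g m n /=; rewrite !homD. Qed.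
Next Obligation. by move=> M N P f g m a /=; rewrite !homM. Qed.

Lemma hcompA M N P Q (f : rhom P Q) (g : rhom N P) (h : rhom M N) :
  hcomp f (hcomp g h) = hcomp (hcomp f g) h.
Proof. exact: homP. Qed.
Lemma hcompDl M N P (f f' : rhom N P) (g : rhom M N) :
  hcomp (f + f') g = hcomp f g + hcomp f' g.
Proof. exact: homP. Qed.
Lemma hcompDr M N P (f : rhom N P) (g g' : rhom M N) :
  hcomp f (g + g') = hcomp f g + hcomp f g'.
Proof. by apply: homP => m /=; rewrite homD. Qed.
Lemma hcomp0l M N P (g : rhom M N) : hcomp (0 : rhom N P) g = 0.
Proof. exact: homP. Qed.
Lemma hcomp0r M N P (f : rhom N P) : hcomp f (0 : rhom M N) = 0.
Proof. by apply: homP => m /=; rewrite hom0. Qed.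

Lemma hom_fsum (I : choiceType) M N (x : I -> rhom M N) m : fsupp x ->
  (\sum_(i \in [set: I]) x i) m = \sum_(i \in [set: I]) x i m.
Proof. by move=> fx; apply: (fsum_map (f := fun f : rhom M N => f m)). Qed.

(* HOM(M, N)_g *)
Definition homdeg M N (g : G) : set (rhom M N) :=
  [set f | forall s m, grdeg M s m -> degprod N g s (f m)].

Lemma degprod_sub (A : grgroup G) g h : subgroup (degprod A g h).
Proof.
rewrite /degprod; case: ifP => _; first exact: deg_sub.
by split=> // a b -> ->; rewrite subr0.
Qed.

Lemma homdeg_sub M N g : subgroup (@homdeg M N g).
Proof.
split=> [s m _|f f' Hf Hf' s m Ms]; first exact: (degprod_sub N g s).1.
by apply: (degprod_sub N g s).2; [exact: Hf|exact: Hf'].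
Qed.

Lemma gmul_inj (g h s : G) : gdom g = gcod s -> gdom h = gcod s ->
  gmul g s = gmul h s -> g = h.
Proof.
move=> gs hs e.
have := congr1 (fun k => gmul k (ginv s)) e.
by rewrite -!gmulA ?gcod_inv // gmulV -{1}gs -hs !gmul1.
Qed.

Lemma homdeg_indep M N (x : G -> rhom M N) :
  (forall g, homdeg g (x g)) -> fsupp x ->
  \sum_(g \in [set: G]) x g = 0 -> forall g, x g = 0.
Proof.
move=> Hx fx x0 g; apply: homP.
apply: homog_ind; rewrite ?hom_zeroE.
- exact: hom0.
- by move=> a b; rewrite homD !hom_zeroE => -> ->; rewrite addr0.
move=> s m Ms; rewrite hom_zeroE.
have := Hx g s m Ms; rewrite /degprod; case: eqP => [gs Ng|//].
have fxm : fsupp (fun h => x h m) by apply: (finsupp_map (f := fun f : rhom M N => f m)).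
have E : \sum_(h \in [set: G]) x h m = 0.
  by rewrite -hom_fsum // x0.
have := congr1 (cpt (gmul g s)) E.
rewrite cpt0 (fsum_map (f := cpt (gmul g s))) //; last 2 first.
- exact: cpt0.
- exact: cptD.
rewrite (@fsum1 _ _ _ g); first by rewrite (cpt_homog _ Ng) eqxx.
move=> h hg; have := Hx h s m Ms; rewrite /degprod.
case: eqP => [hs Nh|_ ->]; last exact: cpt0.
rewrite (cpt_homog _ Nh); case: eqP => // e.
by move/eqP: hg; case; apply: (gmul_inj (s := s)).
Qed.

End RHom.

Record indep_family (G : groupoid) (A : zmodType) := IndepFamily {
  ifam :> G -> set A;
  ifam_sub : forall g, subgroup (ifam g);
  ifam_indep : forall x : G -> A, (forall g, ifam g (x g)) -> fsupp x ->
    \sum_(g \in [set: G]) x g = 0 -> forall g, x g = 0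
}.

(* [gradsum S] is the subgroup generated by the [S g], graded by the [S g]. *)
Section Gradsum.
Variables (G : groupoid) (A : zmodType) (S : indep_family G A).

Record gradsum_type := Gradsum { gsval : A; gsvalP : isum [set: G] S gsval }.

Local Notation T := gradsum_type.

Lemma gsval_inj : injective gsval.
Proof.
move=> [a p] [b q] /= e; move: q; rewrite -e => q.
by congr Gradsum; exact: Prop_irrelevance.
Qed.

HB.instance Definition _ := gen_eqMixin T.
HB.instance Definition _ := gen_choiceMixin T.

Let Ssub := ifam_sub S.
Definition gs_zero : T := Gradsum (isum_subgroup Ssub).1.
Definition gs_opp (a : T) : T :=
  Gradsum (subgroupN (isum_subgroup Ssub) (gsvalP a)).
Definition gs_add (a b : T) : T :=
  Gradsum (subgroupD (isum_subgroup Ssub) (gsvalP a) (gsvalP b)).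

Fact gs_addA : associative gs_add.
Proof. by move=> a b c; apply: gsval_inj; rewrite /= addrA. Qed.
Fact gs_addC : commutative gs_add.
Proof. by move=> a b; apply: gsval_inj; rewrite /= addrC. Qed.
Fact gs_add0 : left_id gs_zero gs_add.
Proof. by move=> a; apply: gsval_inj; rewrite /= add0r. Qed.
Fact gs_addN : left_inverse gs_zero gs_opp gs_add.
Proof. by move=> a; apply: gsval_inj; rewrite /= addNr. Qed.

HB.instance Definition _ :=
  GRing.isZmodule.Build T gs_addA gs_addC gs_add0 gs_addN.

Definition gs_deg (g : G) : set T := [set a | S g (gsval a)].

Lemma gs_degP : direct_decomposition gs_deg.
Proof.
have gD : {morph gsval : a b / a + b} by [].
have sub g : subgroup (gs_deg g).
  split; first exact: (Ssub g).1.
  by move=> a b; exact: (Ssub g).2.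
apply: direct_decomposition_intro => //.
- move=> a; suff : forall b, isum [set: G] S b ->
      exists2 c : T, gsval c = b & isum [set: G] gs_deg c.
    by move=> /(_ _ (gsvalP a))[c /gsval_inj <-].
  apply: isum_ind.
  + by exists 0 => //; exact: (isum_subgroup sub).1.
  + move=> _ _ [c <- Hc] [d <- Hd]; exists (c + d) => //.
    exact: subgroupD (isum_subgroup sub) Hc Hd.
  + move=> g b Sb; exists (Gradsum (isum_homog Ssub Sb)) => //.
    exact: (isum_homog (i := g)).
- move=> x Sx fx x0 g; apply: gsval_inj.
  apply: (@ifam_indep _ _ S (fun g => gsval (x g))) => //.
  + exact: (finsupp_map (f := gsval)).
  + by rewrite -(fsum_map (f := gsval)) // x0.
Qed.

Definition gradsum : grgroup G := GrGroup gs_degP.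

End Gradsum.

Definition hom_family (G : groupoid) (R : grring G) (M N : grmod R) :=
  IndepFamily (@homdeg_sub G R M N) (@homdeg_indep G R M N).

Definition HOM (G : groupoid) (R : grring G) (M N : grmod R) : grgroup G :=
  gradsum (hom_family M N).

Section EndRing.
Variables (G : groupoid) (R : grring G).
Implicit Types M N P : grmod R.

Lemma homdeg_comp M N P g h (f : rhom N P) (f' : rhom M N) :
  homdeg g f -> homdeg h f' ->
  if gdom g == gcod h then homdeg (gmul g h) (hcomp f f') else hcomp f f' = 0.
Proof.
move=> Hf Hf'; case: eqP => gh.
  move=> s m Ms /=; have := Hf' s m Ms; rewrite /degprod gdom_mul //.
  case: eqP => [hs /Hf|_ ->]; last by rewrite hom0.
  by rewrite /degprod gcod_mul // gh eqxx gmulA.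
apply: homP; apply: homog_ind; rewrite ?hom_zeroE.
- exact: hom0.
- by move=> a b; rewrite homD !hom_zeroE => -> ->; rewrite addr0.
move=> s m Ms; have := Hf' s m Ms; rewrite /degprod /=.
case: eqP => [hs /Hf|_ ->]; last by rewrite hom0.
by rewrite /degprod gcod_mul //; case: eqP.
Qed.

Lemma hcomp_closed M N P (f : rhom N P) (f' : rhom M N) :
  isum [set: G] (@homdeg G R N P) f -> isum [set: G] (@homdeg G R M N) f' ->
  isum [set: G] (@homdeg G R M P) (hcomp f f').
Proof.
have SS := isum_subgroup (@homdeg_sub G R M P).
move=> Hf Hf'; move: f Hf; apply: isum_ind.
- by rewrite hcomp0l; case: SS.
- by move=> a b Ha Hb; rewrite hcompDl; exact: subgroupD.
move=> g f Hf; move: f' Hf'; apply: isum_ind.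
- by rewrite hcomp0r; case: SS.
- by move=> a b Ha Hb; rewrite hcompDr; exact: subgroupD.
move=> h f' Hf'; have := homdeg_comp Hf Hf'; case: eqP => _ H.
  exact: (isum_homog (@homdeg_sub G R M P) H).
by rewrite H; case: SS.
Qed.

(* The projection of M onto M(e), which is the identity 1_e of END(M). *)
Program Definition hunit M (e : gobj G) : rhom M M := @RHom G R M M (cproj e) _ _.
Next Obligation. by move=> M e /=; exact: cprojD. Qed.
Next Obligation.
move=> M e m a; move: m; apply: homog_ind.
- by rewrite mact0l cproj0 mact0l.
- by move=> m n Hm Hn; rewrite mactDl !cprojD mactDl Hm Hn.
move=> s m Ms; move: a; apply: homog_ind.
- by rewrite !mact0r cproj0.
- by move=> a b Ha Hb; rewrite !mactDr cprojD Ha Hb.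
move=> t a Ra; have := mact_deg Ms Ra; rewrite /degprod (cproj_homog _ Ms).
case: eqP => [st Mst|_ H].
  by rewrite (cproj_homog _ Mst) gcod_mul //; case: ifP => // _; rewrite mact0l.
by case: ifP => _; rewrite H cproj0 ?mact0l.
Qed.

Lemma hunit_deg M e : homdeg (gid e) (hunit M e).
Proof.
move=> s m Ms; rewrite /degprod gdom_id /= (cproj_homog _ Ms) eq_sym.
by case: eqP => // <-; rewrite gmul1l.
Qed.

Lemma hunitl M N g (f : rhom M N) : homdeg g f -> hcomp (hunit N (gcod g)) f = f.
Proof.
move=> Hf; apply: homP; apply: homog_ind.
- by rewrite !hom0.
- by move=> a b Ha Hb; rewrite !homD Ha Hb.
move=> s m Ms /=; have := Hf s m Ms; rewrite /degprod.
case: eqP => [gs Ns|_ ->]; last by rewrite cproj0.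
by rewrite (cproj_homog _ Ns) gcod_mul // eqxx.
Qed.

Lemma hunitr M N g (f : rhom M N) : homdeg g f -> hcomp f (hunit M (gdom g)) = f.
Proof.
move=> Hf; apply: homP; apply: homog_ind.
- by rewrite !hom0.
- by move=> a b Ha Hb; rewrite !homD Ha Hb.
move=> s m Ms /=; have := Hf s m Ms; rewrite (cproj_homog _ Ms) /degprod eq_sym.
by case: eqP => // _ ->; rewrite hom0.
Qed.

Variable M : grmod R.

Definition end_mul (f f' : HOM M M) : HOM M M :=
  @Gradsum _ _ (hom_family M M) _ (hcomp_closed (gsvalP f) (gsvalP f')).
Definition end_one (e : gobj G) : HOM M M :=
  @Gradsum _ _ (hom_family M M) _ (isum_homog (@homdeg_sub G R M M) (@hunit_deg M e)).

Fact end_mulA a b c : end_mul a (end_mul b c) = end_mul (end_mul a b) c.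
Proof. by apply: gsval_inj; exact: hcompA. Qed.
Fact end_mulDl a b c : end_mul (a + b) c = end_mul a c + end_mul b c.
Proof. by apply: gsval_inj; exact: hcompDl. Qed.
Fact end_mulDr a b c : end_mul a (b + c) = end_mul a b + end_mul a c.
Proof. by apply: gsval_inj; exact: hcompDr. Qed.
Fact end_deg g h a b : grdeg (HOM M M) g a -> grdeg (HOM M M) h b ->
  degprod (HOM M M) g h (end_mul a b).
Proof.
move=> Ha Hb; rewrite /degprod; have := homdeg_comp Ha Hb; case: eqP => _ //.
by move=> H; apply: gsval_inj.
Qed.
Fact end_one_deg e : grdeg (HOM M M) (gid e) (end_one e).
Proof. exact: hunit_deg. Qed.
Fact end_mul1l g a : grdeg (HOM M M) g a -> end_mul (end_one (gcod g)) a = a.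
Proof. by move=> Ha; apply: gsval_inj; exact: hunitl. Qed.
Fact end_mul1r g a : grdeg (HOM M M) g a -> end_mul a (end_one (gdom g)) = a.
Proof. by move=> Ha; apply: gsval_inj; exact: hunitr. Qed.

Definition END : grring G :=
  GrRing end_mulA end_mulDl end_mulDr end_deg end_one_deg end_mul1l end_mul1r.

End EndRing.

Section DirectSum.
Variables (G : groupoid) (R : grring G) (J : choiceType) (M : J -> grmod R).

Record dsum_type := DSum {
  dval :> forall j, M j;
  dvalP : finite_set [set j | dval j != 0]
}.

Lemma dsumP (x y : dsum_type) : (forall j, x j = y j) -> x = y.
Proof.
case: x y => [x p] [y q] /= h.
have e : x = y by apply: functional_extensionality_dep.
by move: q; rewrite -e => q; congr DSum; exact: Prop_irrelevance.
Qed.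

HB.instance Definition _ := gen_eqMixin dsum_type.
HB.instance Definition _ := gen_choiceMixin dsum_type.

Program Definition dsum_zero := @DSum (fun=> 0) _.
Next Obligation.
by apply: (sub_finite_set _ (finite_set0 J)) => j /=; rewrite eqxx.
Qed.
Program Definition dsum_opp (x : dsum_type) := @DSum (fun j => - x j) _.
Next Obligation.
move=> x; apply: (sub_finite_set _ (dvalP x)) => j /=.
by apply: contra_neq => ->; rewrite oppr0.
Qed.
Program Definition dsum_add (x y : dsum_type) := @DSum (fun j => x j + y j) _.
Next Obligation.
move=> x y.
have /(sub_finite_set _) : finite_set ([set j | x j != 0] `|` [set j | y j != 0]).
  by rewrite finite_setU; split; exact: dvalP.
apply=> j /=; apply: contra_neqP => /not_orP[/negP/negPn/eqP-> /negP/negPn/eqP->].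
by rewrite addr0.
Qed.

Fact dsum_addA : associative dsum_add.
Proof. by move=> a b c; apply: dsumP => j /=; rewrite addrA. Qed.
Fact dsum_addC : commutative dsum_add.
Proof. by move=> a b; apply: dsumP => j /=; rewrite addrC. Qed.
Fact dsum_add0 : left_id dsum_zero dsum_add.
Proof. by move=> a; apply: dsumP => j /=; rewrite add0r. Qed.
Fact dsum_addN : left_inverse dsum_zero dsum_opp dsum_add.
Proof. by move=> a; apply: dsumP => j /=; rewrite addNr. Qed.

HB.instance Definition _ :=
  GRing.isZmodule.Build dsum_type dsum_addA dsum_addC dsum_add0 dsum_addN.

Lemma dsum_addE (x y : dsum_type) j : (x + y) j = x j + y j.
Proof. by []. Qed.

Program Definition dinj j (m : M j) : dsum_type :=
  @DSum (dfwith (T := fun j => M j) (fun=> 0) m) _.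
Next Obligation.
move=> j m; apply: (sub_finite_set _ (finite_set1 j)) => i /=.
by apply: contra_neqP => /eqP; rewrite eq_sym => ij; rewrite dfwith_out.
Qed.

Lemma dinj_in j (m : M j) : dinj m j = m.
Proof. exact: dfwith_in. Qed.
Lemma dinj_out j i (m : M j) : j != i -> dinj m i = 0.
Proof. by move=> ji; rewrite /= dfwith_out. Qed.

Lemma dinjD j : {morph @dinj j : m n / m + n}.
Proof.
move=> m n; apply: dsumP => i; rewrite dsum_addE.
case: (eqVneq j i) => [<-|ji]; first by rewrite !dinj_in.
by rewrite !dinj_out ?addr0.
Qed.
Lemma dinj0 j : @dinj j 0 = 0.
Proof.
apply: dsumP => i; case: (eqVneq j i) => [<-|ji]; first exact: dinj_in.
by rewrite dinj_out.
Qed.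

Lemma dsum_ind (P : dsum_type -> Prop) : P 0 ->
  (forall a b, P a -> P b -> P (a + b)) -> (forall j (m : M j), P (dinj m)) ->
  forall x, P x.
Proof.
move=> P0 PD Pi x.
have fx : fsupp (fun j => dinj (x j)).
  apply: (sub_finite_set _ (dvalP x)) => j /=.
  by apply: contra_neq => ->; exact: dinj0.
suff -> : x = \sum_(j \in [set: J]) dinj (x j) by apply: fsum_closed.
apply: dsumP => i.
rewrite (fsum_map (f := fun y : dsum_type => y i)) //.
rewrite (@fsum1 _ _ _ i); first by rewrite dinj_in.
by move=> j ji; rewrite dinj_out.
Qed.

Definition dsum_deg (g : G) : set dsum_type :=
  [set x | forall j, grdeg (M j) g (x j)].

Lemma dinj_deg g j (m : M j) : grdeg (M j) g m -> dsum_deg g (dinj m).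
Proof.
move=> Mm i; case: (eqVneq j i) => [<-|ji]; first by rewrite dinj_in.
by rewrite dinj_out //; exact: deg0.
Qed.

Lemma dsum_degP : direct_decomposition dsum_deg.
Proof.
have sub g : subgroup (dsum_deg g).
  split=> [j|x y Hx Hy j]; first exact: deg0.
  by apply: subgroupB (deg_sub _ _) (Hx j) (Hy j).
have SS := isum_subgroup sub.
apply: direct_decomposition_intro => //.
- apply: dsum_ind => [||j]; first by case: SS.
    by move=> a b; exact: subgroupD.
  apply: homog_ind; first by rewrite dinj0; case: SS.
    by move=> a b; rewrite dinjD; exact: subgroupD.
  by move=> g a Ma; apply: (isum_homog (i := g) sub); exact: dinj_deg.
- move=> x Sx fx x0 g; apply: dsumP => j.
  have fxj : fsupp (fun g => x g j).
    exact: (finsupp_map (f := fun y : dsum_type => y j)).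
  rewrite -(@cpt_uniq _ (M j) (fun g => x g j) 0) ?cpt0 //.
    by move=> h; exact: Sx.
  by rewrite -(fsum_map (f := fun y : dsum_type => y j)) // x0.
Qed.

Definition dsum_grp : grgroup G := GrGroup dsum_degP.

Program Definition dsum_act (x : dsum_grp) (a : R) : dsum_grp :=
  @DSum (fun j => mact (dval x j) a) _.
Next Obligation.
move=> x a; apply: (sub_finite_set _ (dvalP x)) => j /=.
by apply: contra_neq => ->; rewrite mact0l.
Qed.

Fact dsum_actA m a b : dsum_act m (rmul a b) = dsum_act (dsum_act m a) b.
Proof. by apply: dsumP => j; exact: mactA. Qed.
Fact dsum_actDl m n a : dsum_act (m + n) a = dsum_act m a + dsum_act n a.
Proof. by apply: dsumP => j; exact: mactDl. Qed.
Fact dsum_actDr m a b : dsum_act m (a + b) = dsum_act m a + dsum_act m b.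
Proof. by apply: dsumP => j; exact: mactDr. Qed.
Fact dsum_act_deg g h m a : grdeg dsum_grp g m -> grdeg R h a ->
  degprod dsum_grp g h (dsum_act m a).
Proof.
move=> Mm Ra; have H j := mact_deg (Mm j) Ra.
rewrite /degprod; move: H; rewrite /degprod; case: eqP => _ H.
  by move=> j; exact: H.
by apply: dsumP => j; exact: H.
Qed.
Fact dsum_act_full m : exists s : seq (dsum_grp * R),
  m = \sum_(p <- s) dsum_act p.1 p.2.
Proof.
move: m; apply: dsum_ind.
- by exists [::]; rewrite big_nil.
- by move=> _ _ [s ->] [t ->]; exists (s ++ t); rewrite big_cat.
move=> j m; have [s ->] := mact_full m.
exists [seq (dinj p.1 : dsum_grp, p.2) | p <- s].
rewrite big_map (big_morph (@dinj j) (@dinjD j) (dinj0 j)).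
apply: eq_bigr => -[n a] _ /=; apply: dsumP => i /=.
case: (eqVneq j i) => [<-|ji]; first by rewrite !dfwith_in.
by rewrite !dfwith_out // mact0l.
Qed.

Definition dsum : grmod R := GrMod dsum_actA dsum_actDl dsum_actDr
  dsum_act_deg dsum_act_full.

Program Definition dincl j : rhom (M j) dsum := @RHom G R (M j) dsum (@dinj j) _ _.
Next Obligation. exact: dinjD. Qed.
Next Obligation.
move=> j m a; apply: dsumP => i /=.
case: (eqVneq j i) => [<-|ji]; first by rewrite !dfwith_in.
by rewrite !dfwith_out // mact0l.
Qed.

Definition dproj j : rhom dsum (M j) :=
  @RHom G R dsum (M j) (fun x => dval x j) (fun _ _ => erefl) (fun _ _ => erefl).

End DirectSum.

Arguments dincl {G R J} M j.
Arguments dproj {G R J} M j.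

Section Matrices.
Variables (G : groupoid) (R : grring G) (I J : choiceType).
Variables (M : J -> grmod R) (N : I -> grmod R).

Record homx := HomMx { mxfun :> forall i j, rhom (M j) (N i) }.

Lemma homxP (A B : homx) : (forall i j, A i j = B i j) -> A = B.
Proof.
case: A B => [A] [B] /= e; congr HomMx; apply: functional_extensionality_dep => i.
by apply: functional_extensionality_dep => j.
Qed.

HB.instance Definition _ := gen_eqMixin homx.
HB.instance Definition _ := gen_choiceMixin homx.

Definition homx_zero := HomMx (fun i j => 0).
Definition homx_opp (A : homx) := HomMx (fun i j => - A i j).
Definition homx_add (A B : homx) := HomMx (fun i j => A i j + B i j).

Fact homx_addA : associative homx_add.
Proof. by move=> a b c; apply: homxP => i j /=; rewrite addrA. Qed.
Fact homx_addC : commutative homx_add.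
Proof. by move=> a b; apply: homxP => i j /=; rewrite addrC. Qed.
Fact homx_add0 : left_id homx_zero homx_add.
Proof. by move=> a; apply: homxP => i j /=; rewrite add0r. Qed.
Fact homx_addN : left_inverse homx_zero homx_opp homx_add.
Proof. by move=> a; apply: homxP => i j /=; rewrite addNr. Qed.

HB.instance Definition _ :=
  GRing.isZmodule.Build homx homx_addA homx_addC homx_add0 homx_addN.

Definition column_finite (A : homx) : Prop :=
  forall j, finite_set [set i | A i j != 0].

(* H_{I x J}(M, N)_g; the sum of these groups is [Hmx] below. *)
Definition homx_deg (g : G) : set homx :=
  [set A | column_finite A /\ forall i j, homdeg g (A i j)].

Lemma column_finite_sub : subgroup column_finite.
Proof.
split.
  by move=> j; apply: (sub_finite_set _ (finite_set0 I)) => i /=; rewrite eqxx.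
move=> A B fA fB j.
have /(sub_finite_set _) : finite_set ([set i | A i j != 0] `|` [set i | B i j != 0]).
  by rewrite finite_setU.
apply=> i /=; apply: contra_neqP => /not_orP[/negP/negPn/eqP A0 /negP/negPn/eqP B0].
by rewrite A0 B0 oppr0 addr0.
Qed.

Lemma homx_deg_sub g : subgroup (homx_deg g).
Proof.
split.
  split; first exact: column_finite_sub.1.
  by move=> i j; exact: (homdeg_sub _ _ _).1.
move=> A B [fA dA] [fB dB]; split; first exact: column_finite_sub.2.
by move=> i j; apply: (homdeg_sub _ _ _).2.
Qed.

Lemma homx_indep (x : G -> homx) : (forall g, homx_deg g (x g)) -> fsupp x ->
  \sum_(g \in [set: G]) x g = 0 -> forall g, x g = 0.
Proof.
move=> Hx fx x0 g; apply: homxP => i j.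
apply: (homdeg_indep (x := fun g => x g i j)).
- by move=> h; case: (Hx h).
- exact: (finsupp_map (f := fun A : homx => A i j)).
- by rewrite -(fsum_map (f := fun A : homx => A i j)) // x0.
Qed.

Lemma isum_column_finite A : isum [set: G] homx_deg A -> column_finite A.
Proof.
move: A; apply: isum_ind; first exact: column_finite_sub.1.
  by move=> a b; exact: subgroupD column_finite_sub.
by move=> g a [].
Qed.

Definition homx_family := IndepFamily homx_deg_sub homx_indep.
Definition Hmx : grgroup G := gradsum homx_family.

End Matrices.

Section MatrixRing.
Variables (G : groupoid) (R : grring G) (J : choiceType) (M : J -> grmod R).
Local Notation mat := (homx M M).
Implicit Types A B C : mat.

(* If [B] is column finite, then the sum has finite support. *)
Definition homx_mul A B : mat :=
  HomMx (fun i k => \sum_(j \in [set: J]) hcomp (A i j) (B j k)).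

Lemma mul_supp A B i k : column_finite B ->
  fsupp (fun j => hcomp (A i j) (B j k)).
Proof.
move=> fB; apply: (sub_finite_set _ (fB k)) => j /=.
by apply: contra_neq => ->; exact: hcomp0r.
Qed.

Lemma column_seq A (k : J) : column_finite A ->
  exists2 r : seq J, uniq r & forall j, j \notin r -> A j k = 0.
Proof.
move=> /(_ k)/finite_seq_of[r ur rP]; exists r => // j.
by apply: contraNeq => Aj; apply/rP.
Qed.

Lemma homx_mulDl A B C : column_finite C ->
  homx_mul (A + B) C = homx_mul A C + homx_mul B C.
Proof.
move=> fC; apply: homxP => i k /=.
rewrite -fsumD; try exact: mul_supp.
by apply: fsum_eq => j; exact: hcompDl.
Qed.

Lemma homx_mulDr A B C : column_finite B -> column_finite C ->
  homx_mul A (B + C) = homx_mul A B + homx_mul A C.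
Proof.
move=> fB fC; apply: homxP => i k /=.
rewrite -fsumD; try exact: mul_supp.
by apply: fsum_eq => j; exact: hcompDr.
Qed.

Lemma homx_mul0l A : homx_mul 0 A = 0.
Proof. by apply: homxP => i k; apply: fsbig1 => j _; exact: hcomp0l. Qed.
Lemma homx_mul0r A : homx_mul A 0 = 0.
Proof. by apply: homxP => i k; apply: fsbig1 => j _; exact: hcomp0r. Qed.

Lemma columns_seq A (r : seq J) : column_finite A ->
  exists2 s : seq J, uniq s & forall j k, k \in r -> j \notin s -> A j k = 0.
Proof.
move=> fA; elim: r => [|l r [s us sP]]; first by exists [::].
have [t ut tP] := column_seq l fA.
exists (undup (s ++ t)); first exact: undup_uniq.
move=> j m; rewrite inE mem_undup mem_cat negb_or.
by move=> /predU1P[->|mr] /andP[js jt]; [exact: tP|exact: sP].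
Qed.

Lemma homx_mul_fin A B : column_finite A -> column_finite B ->
  column_finite (homx_mul A B).
Proof.
move=> fA fB k; have [r ur rP] := column_seq k fB.
have [s us sP] := columns_seq r fA.
apply: (sub_finite_set _ (finite_seq s)) => i /=.
apply: contra_neqT => is_; apply: fsbig1 => j _.
case: (boolP (j \in r)) => [jr|/rP ->]; last exact: hcomp0r.
by rewrite (sP _ _ jr is_) hcomp0l.
Qed.

Lemma homx_mulA A B C : column_finite B -> column_finite C ->
  homx_mul A (homx_mul B C) = homx_mul (homx_mul A B) C.
Proof.
move=> fB fC; apply: homxP => i l /=.
have [r ur rP] := column_seq l fC.
have [s us sP] := columns_seq r fB.
have BC0 j : j \notin s -> homx_mul B C j l = 0.
  move=> js; apply: fsbig1 => k _.
  case: (boolP (k \in r)) => [kr|/rP ->]; last exact: hcomp0r.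
  by rewrite (sP _ _ kr js) hcomp0l.
rewrite (fsumE us); last by move=> j /BC0 /= ->; exact: hcomp0r.
rewrite (fsumE ur); last by move=> k /rP /= ->; exact: hcomp0r.
transitivity (\sum_(j <- s) \sum_(k <- r) hcomp (A i j) (hcomp (B j k) (C k l))).
  apply: eq_bigr => j _; rewrite (fsumE ur); last first.
    by move=> k /rP ->; exact: hcomp0r.
  by apply: big_morph; [exact: hcompDr|exact: hcomp0r].
rewrite exchange_big /= [LHS]big_seq [RHS]big_seq; apply: eq_bigr => k kr.
rewrite (fsumE us); last by move=> j js; rewrite (sP _ _ kr js) hcomp0r.
rewrite (big_morph (fun f => hcomp f (C k l)) (id1 := 0) (op1 := +%R)).
- by apply: eq_bigr => j _; exact: hcompA.
- by move=> f f'; exact: hcompDl.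
- exact: hcomp0l.
Qed.

Lemma homx_mul_deg g h A B : homx_deg g A -> homx_deg h B ->
  if gdom g == gcod h then homx_deg (gmul g h) (homx_mul A B)
  else homx_mul A B = 0.
Proof.
move=> [fA dA] [fB dB].
have H i j k := homdeg_comp (dA i j) (dB j k).
case: eqP H => _ H.
  split; first exact: homx_mul_fin.
  move=> i k; apply: fsum_closed => // [|a b]; first exact: (homdeg_sub _ _ _).1.
  exact: subgroupD (homdeg_sub _ _ _).
by apply: homxP => i k; apply: fsbig1 => j _; exact: H.
Qed.

Lemma homx_mul_closed A B :
  isum [set: G] (@homx_deg G R J J M M) A ->
  isum [set: G] (@homx_deg G R J J M M) B ->
  isum [set: G] (@homx_deg G R J J M M) (homx_mul A B).
Proof.
have SS := isum_subgroup (@homx_deg_sub G R J J M M).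
move=> HA HB; move: A HA; apply: isum_ind.
- by rewrite homx_mul0l; case: SS.
- move=> A A' HA HA'; rewrite homx_mulDl; first exact: subgroupD.
  exact: isum_column_finite.
move=> g A HA.
suff [] : column_finite B /\ isum [set: G] (@homx_deg G R J J M M) (homx_mul A B) by [].
move: B HB; apply: isum_ind.
- by rewrite homx_mul0r; split; [exact: (@column_finite_sub G R J J M M).1|case: SS].
- move=> B B' [fB HB] [fB' HB']; split; first exact: subgroupD (@column_finite_sub G R J J M M) fB fB'.
  by rewrite homx_mulDr //; exact: subgroupD.
move=> h B HB; split; first by case: HB.
have := homx_mul_deg HA HB; case: eqP => _ H; first exact: (isum_homog (@homx_deg_sub G R J J M M) H).
by rewrite H; case: SS.
Qed.

(* The diagonal matrix of the projections of the M j onto the M j (e). *)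
Definition homx_one (e : gobj G) : mat :=
  HomMx (fun i j => hcomp (dproj M i) (hcomp (dincl M j) (hunit (M j) e))).

Lemma homx_one_in e j : homx_one e j j = hunit (M j) e.
Proof. by apply: homP => m; exact: dinj_in. Qed.
Lemma homx_one_out e i j : j != i -> homx_one e i j = 0.
Proof. by move=> ji; apply: homP => m; exact: dinj_out. Qed.

Lemma homx_one_deg e : homx_deg (gid e) (homx_one e).
Proof.
split=> [j|i j].
  apply: (sub_finite_set _ (finite_set1 j)) => i /=.
  by apply: contra_neqP => /eqP; rewrite eq_sym; exact: homx_one_out.
case: (eqVneq j i) => [<-|ji]; first by rewrite homx_one_in; exact: hunit_deg.
by rewrite homx_one_out //; exact: (homdeg_sub _ _ _).1.
Qed.

Local Notation H := (Hmx M M).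

Definition hmx_mul (A B : H) : H :=
  @Gradsum _ _ (homx_family M M) _ (homx_mul_closed (gsvalP A) (gsvalP B)).
Definition hmx_one (e : gobj G) : H :=
  @Gradsum _ _ (homx_family M M) _ (isum_homog (@homx_deg_sub G R J J M M) (homx_one_deg e)).

Lemma hmx_fin (A : H) : column_finite (gsval A : mat).
Proof. exact: isum_column_finite (gsvalP A). Qed.

Fact hmx_mulA a b c : hmx_mul a (hmx_mul b c) = hmx_mul (hmx_mul a b) c.
Proof. by apply: gsval_inj; apply: homx_mulA; exact: hmx_fin. Qed.
Fact hmx_mulDl a b c : hmx_mul (a + b) c = hmx_mul a c + hmx_mul b c.
Proof. by apply: gsval_inj; apply: homx_mulDl; exact: hmx_fin. Qed.
Fact hmx_mulDr a b c : hmx_mul a (b + c) = hmx_mul a b + hmx_mul a c.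
Proof. by apply: gsval_inj; apply: homx_mulDr; exact: hmx_fin. Qed.
Fact hmx_deg g h a b : grdeg H g a -> grdeg H h b ->
  degprod H g h (hmx_mul a b).
Proof.
move=> Ha Hb; rewrite /degprod; have := homx_mul_deg Ha Hb; case: eqP => _ //.
by move=> E; apply: gsval_inj.
Qed.
Fact hmx_one_deg e : grdeg H (gid e) (hmx_one e).
Proof. exact: homx_one_deg. Qed.
Fact hmx_mul1l g a : grdeg H g a -> hmx_mul (hmx_one (gcod g)) a = a.
Proof.
move=> [_ Ha]; apply: gsval_inj; apply: homxP => i k; rewrite [LHS](@fsum1 _ _ _ i).
  by rewrite homx_one_in; exact: hunitl.
by move=> j ji; rewrite homx_one_out // hcomp0l.
Qed.
Fact hmx_mul1r g a : grdeg H g a -> hmx_mul a (hmx_one (gdom g)) = a.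
Proof.
move=> [_ Ha]; apply: gsval_inj; apply: homxP => i k; rewrite [LHS](@fsum1 _ _ _ k).
  by rewrite homx_one_in; exact: hunitr.
by move=> j jk; rewrite homx_one_out 1?eq_sym // hcomp0r.
Qed.

Definition Hring : grring G :=
  GrRing hmx_mulA hmx_mulDl hmx_mulDr hmx_deg hmx_one_deg hmx_mul1l hmx_mul1r.

End MatrixRing.

Arguments Hmx {G R I J} M N.
Arguments Hring {G R J} M.

(* Every homogeneous homomorphism from some [M j] to [dsum N] has its image in
   a finite subsum. *)
Definition finite_images (G : groupoid) (R : grring G) (I J : choiceType)
    (M : J -> grmod R) (N : I -> grmod R) : Prop :=
  forall (j : J) (g : G) (f : rhom (M j) (dsum N)), homdeg g f ->
    exists2 K : set I, finite_set K &
      range f `<=` isum K (fun i => range (dincl N i)).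

Definition natural_matrix (G : groupoid) (R : grring G) (I J : choiceType)
    (M : J -> grmod R) (N : I -> grmod R) (f : rhom (dsum M) (dsum N)) :
    homx M N :=
  HomMx (fun i j => hcomp (dproj N i) (hcomp f (dincl M j))).

(* Main.v *)
Require Import Defs.
From HB Require Import structures.
From mathcomp Require Import all_boot all_algebra.
From mathcomp Require Import boolp classical_sets functions cardinality fsbigop.

Set Implicit Arguments.
Unset Strict Implicit.
Unset Printing Implicit Defensive.
Import GRing.Theory.
Local Open Scope classical_set_scope.
Local Open Scope ring_scope.

(** A homomorphism out of [dsum M] is determined by its restrictions to the
    summands, and an element of [dsum N] by its coordinates, so [natural_matrix]
    is additive and injective for any two families ([natural_matrix_inj]).
    Conversely a column finite matrix [A] acts on [x] by the usual formula
    [\sum_j A i j (x j)]: only the columns in the support of [x] contribute, and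
    each of them has finitely many nonzero entries, so the result lies in
    [dsum N].  This homomorphism [matrix_hom] has matrix [A].  Both passages
    preserve degrees, since the degree condition in a direct sum is
    coordinatewise ([degprod_dsum]).

    The one thing that may fail is that the matrix of a homogeneous [f] be
    column finite.  Its [j]-th column consists of the coordinates of the
    homogeneous map [hcomp f (dincl M j)], so [finite_images] is exactly what
    makes that column finite ([natural_matrix_deg]).  Thus [natural_matrix] maps
    each [HOM(M, N)_g] bijectively onto [H(M, N)_g], and injectivity on the
    whole group of homomorphisms turns this into an isomorphism of the graded
    groups that these components generate ([gradsum_iso]).  On endomorphisms it
    is multiplicative because inserting [x = \sum_j dincl M j (dproj M j x)]
    between two composed maps gives matrix multiplication
    ([natural_matrix_comp]).

    For the last claim, a homomorphism of degree [g] kills every component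
    [M_s] with [gcod s != gdom g], hence it vanishes when [M(gdom g) = 0].  So
    a matrix of degree [g] lives in the columns [j] with [M_j(gdom g) != 0].
    These [j] lie in the finite set that carries [M(gdom g)] ([corner_eq0]), and
    each column is finite.  A general matrix is a finite sum of such ones. *)

(** * Graded groups generated by independent families *)

(** The sum of the [T g] is generated by its components, so it is enough that
    [phi] maps each [S g] onto [T g]; an inverse exists because [phi] is
    injective, and its values are chosen classically. *)
Lemma gradsum_iso (G : groupoid) (A B : zmodType)
    (S : indep_family G A) (T : indep_family G B) (phi : A -> B) :
  {morph phi : a b / a + b} -> injective phi ->
  (forall g a, S g a -> T g (phi a)) ->
  (forall g b, T g b -> exists2 a, S g a & phi a = b) ->
  exists F : gradsum S -> gradsum T,
    gr_iso F /\ forall a, gsval (F a) = phi (gsval a).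
Proof.
move=> phiD phi_inj phiS phiT.
have phi0 : phi 0 = 0.
  by apply: (addrI (phi 0)); rewrite -phiD !addr0.
have SS := isum_subgroup (ifam_sub S).
have TT := isum_subgroup (ifam_sub T).
have into a : isum [set: G] S a -> isum [set: G] T (phi a).
  move: a; apply: isum_ind => [|a b Ha Hb|g a /phiS Ta].
  - by rewrite phi0; case: TT.
  - by rewrite phiD; exact: subgroupD.
  - exact: isum_homog (ifam_sub T) Ta.
have onto b : isum [set: G] T b -> exists2 a, isum [set: G] S a & phi a = b.
  move: b; apply: isum_ind => [|_ _ [a Sa <-] [b Sb <-]|g b /phiT[a Sa <-]].
  - by exists 0 => //; case: SS.
  - by exists (a + b) => //; exact: subgroupD.
  - by exists a => //; exact: isum_homog (ifam_sub S) Sa.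
pose F (a : gradsum S) : gradsum T := Gradsum (into _ (gsvalP a)).
have Finj : injective F.
  by move=> a b /(congr1 (@gsval _ _ _)) /= /phi_inj; exact: gsval_inj.
have /boolp.choice[F' FF'] b : exists a : gradsum S, F a = b.
  have [a Sa ab] := onto _ (gsvalP b).
  by exists (Gradsum Sa); exact: gsval_inj.
exists F; split=> //; split.
- by move=> a b; apply: gsval_inj; exact: phiD.
- by exists F' => // a; apply: Finj.
- by move=> g a; exact: phiS.
Qed.

(** * Direct sums *)

Section DirectSums.
Variables (G : groupoid) (R : grring G) (J : choiceType) (M : J -> grmod R).

Lemma dsum_supp (x : dsum M) : fsupp (fun j => dincl M j (dproj M j x)).
Proof.
apply: (sub_finite_set _ (dvalP x)) => j /=.
by apply: contra_neq => ->; exact: dinj0.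
Qed.

Lemma dsum_sum (x : dsum M) :
  x = \sum_(j \in [set: J]) dincl M j (dproj M j x).
Proof.
apply: dsumP => i; rewrite -[RHS]/(dproj M i _).
rewrite (fsum_map (f := dproj M i)) //; last exact: dsum_supp.
rewrite (@fsum1 _ _ _ i); first by rewrite /= dfwith_in.
by move=> j ji; rewrite /= dfwith_out.
Qed.

Lemma degprod_dsum g s (x : dsum M) :
  degprod (dsum M) g s x <-> forall j, degprod (M j) g s (dproj M j x).
Proof.
rewrite /degprod; case: ifP => _ //; split; first by move=> ->.
by move=> x0; apply: dsumP => j; exact: x0.
Qed.

(** The [S j] are taken inside the images of the inclusions so that the same
    lemma serves for sums of whole summands and for sums of their corners. *)
Lemma isum_dincl_out (K : set J) (S : J -> set (dsum M)) (x : dsum M) i :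
  (forall j, S j `<=` range (dincl M j)) -> isum K S x -> ~ K i ->
  dproj M i x = 0.
Proof.
move=> SM [y [Sy _ ->]] Ki; rewrite fsbig_mkcond.
apply: (@fsum_closed _ _ (fun z => dproj M i z = 0)) => //.
  by move=> a b; rewrite homD => -> ->; rewrite addr0.
move=> j; rewrite /patch; case: ifP => //; rewrite inE => Kj.
have [m _ <-] := SM _ _ (Sy j).
by apply: dinj_out; apply/eqP => ji; apply: Ki; rewrite -ji.
Qed.

Lemma rhom_dsum_ext (P : grmod R) (f f' : rhom (dsum M) P) :
  (forall j m, f (dincl M j m) = f' (dincl M j m)) -> f = f'.
Proof.
move=> ff'; apply: homP; apply: dsum_ind => [|a b|j m]; last exact: ff'.
  by rewrite !hom0.
by rewrite !homD => -> ->.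
Qed.

End DirectSums.

(** * The matrix of a homomorphism *)

Section NaturalMatrix.
Variables (G : groupoid) (R : grring G) (I J : choiceType).
Variables (M : J -> grmod R) (N : I -> grmod R).

Lemma natural_matrixD :
  {morph @natural_matrix G R I J M N : f f' / f + f'}.
Proof. by move=> f f'; apply: homxP => i j; apply: homP. Qed.

Lemma natural_matrix_inj : injective (@natural_matrix G R I J M N).
Proof.
move=> f f' ff'; apply: rhom_dsum_ext => j m; apply: dsumP => i.
exact: (congr1 (fun A : homx M N => A i j m) ff').
Qed.

Lemma natural_matrix_deg g (f : rhom (dsum M) (dsum N)) :
  finite_images M N -> homdeg g f -> homx_deg g (natural_matrix f).
Proof.
move=> fin fg.
have fjg j : homdeg g (hcomp f (dincl M j)).
  by move=> s m Ms; apply: fg; exact: dinj_deg.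
split=> [j|i j s m Ms]; last by have /degprod_dsum := fjg j s m Ms.
have [K fK fjK] := fin j g _ (fjg j).
apply: (sub_finite_set _ fK) => i; apply: contra_neqP => Ki.
apply: homP => m.
by apply: isum_dincl_out (fjK _ (imageT _ m)) Ki => k x.
Qed.

Lemma matrix_hom_supp (A : homx M N) (x : dsum M) i :
  fsupp (fun j => A i j (dproj M j x)).
Proof.
apply: (sub_finite_set _ (dvalP x)) => j /=.
by apply: contra_neq => ->; exact: hom0.
Qed.

Lemma matrix_hom_finite (A : homx M N) (x : dsum M) : column_finite A ->
  finite_set [set i | \sum_(j \in [set: J]) A i j (dproj M j x) != 0].
Proof.
move=> fA.
have : finite_set (\bigcup_(j in [set j | dproj M j x != 0])
    [set i | A i j != 0]).
  by apply: bigcup_finite => [|j _]; [exact: dvalP|exact: fA].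
apply: sub_finite_set => i; apply: contra_neqP => Ai; apply: fsbig1 => j _.
have [->|xj] := eqVneq (dproj M j x) 0; first exact: hom0.
have [->//|Aij] := eqVneq (A i j) 0.
by case: Ai; exists j.
Qed.

Section MatrixHom.
Variables (A : homx M N) (fA : column_finite A).

Definition matrix_fun (x : dsum M) : dsum N := DSum (matrix_hom_finite x fA).

Fact matrix_funD : {morph matrix_fun : x y / x + y}.
Proof.
move=> x y; apply: dsumP => i /=.
rewrite -fsumD; try exact: matrix_hom_supp.
by apply: fsum_eq => j; exact: homD.
Qed.

Fact matrix_funM x (a : R) : matrix_fun (mact x a) = mact (matrix_fun x) a.
Proof.
apply: dsumP => i /=.
rewrite (fsum_map (f := fun n : N i => mact n a)).
- by apply: fsum_eq => j; exact: homM.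
- exact: mact0l.
- by move=> m n; exact: mactDl.
- exact: matrix_hom_supp.
Qed.

(** Left multiplication by [A] on column vectors. *)
Definition matrix_hom : rhom (dsum M) (dsum N) := RHom matrix_funD matrix_funM.

End MatrixHom.

Lemma matrix_homK (A : homx M N) (fA : column_finite A) :
  natural_matrix (matrix_hom fA) = A.
Proof.
apply: homxP => i j; apply: homP => m /=; rewrite (@fsum1 _ _ _ j).
  by rewrite dfwith_in.
by move=> k kj; rewrite dfwith_out 1?eq_sym // hom0.
Qed.

Lemma matrix_hom_deg g (A : homx M N) (fA : column_finite A) :
  homx_deg g A -> homdeg g (matrix_hom fA).
Proof.
move=> [_ Ag] s x xs; apply/degprod_dsum => i /=.
have Ng := degprod_sub (N i) g s.
apply: fsum_closed => [|a b|j]; [exact: Ng.1|exact: subgroupD|].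
exact: (Ag i j s _ (xs j)).
Qed.

Lemma natural_matrix_iso : finite_images M N ->
  exists F : HOM (dsum M) (dsum N) -> Hmx M N,
    gr_iso F /\ forall f, gsval (F f) = natural_matrix (gsval f).
Proof.
move=> fin; apply: gradsum_iso.
- exact: natural_matrixD.
- exact: natural_matrix_inj.
- by move=> g f; exact: natural_matrix_deg.
- move=> g A Ag; exists (matrix_hom Ag.1); last exact: matrix_homK.
  exact: matrix_hom_deg.
Qed.

End NaturalMatrix.

(** Column finiteness of the right factor makes the entries of the product
    finite sums. *)
Lemma natural_matrix_comp (G : groupoid) (R : grring G) (J : choiceType)
    (M : J -> grmod R) (f f' : rhom (dsum M) (dsum M)) :
  column_finite (natural_matrix f') ->
  natural_matrix (hcomp f f') =
    homx_mul (natural_matrix f) (natural_matrix f').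
Proof.
move=> fin; apply: homxP => i k; apply: homP => m.
rewrite [RHS]hom_fsum; last exact: mul_supp.
rewrite -[LHS]/(dproj M i (f (f' (dincl M k m)))) [f' _]dsum_sum.
rewrite (fsum_map (f := fun x => dproj M i (f x))) //.
- by rewrite !hom0.
- by move=> x y; rewrite !homD.
- exact: dsum_supp.
Qed.

(** * Finitely many nonzero entries *)

Section FiniteMatrices.
Variables (G : groupoid) (R : grring G).

Lemma corner_homog (A : grgroup G) s a : grdeg A s a -> corner A (gcod s) a.
Proof.
move=> As; exists (fun t => if t == s then a else 0); split.
- by move=> t; case: eqP => [->|_] //; exact: deg0.
- by apply: (@seq_finsupp _ _ [:: s]) => t; rewrite inE => /negPf ->.
rewrite fsbig_mkcond (@fsum1 _ _ _ s) /patch.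
  by rewrite mem_set // eqxx.
by move=> t /negPf ->; case: ifP.
Qed.

Lemma homdeg_eq0 (M N : grmod R) g (f : rhom M N) :
  (forall s m, gcod s = gdom g -> grdeg M s m -> m = 0) ->
  homdeg g f -> f = 0.
Proof.
move=> M0 fg; apply: homP; apply: homog_ind; first exact: hom0.
  by move=> a b; rewrite homD => -> ->; exact: addr0.
move=> s m Ms; have := fg s m Ms; rewrite /degprod.
by case: eqP => // gs _; rewrite (M0 s m) // hom0.
Qed.

Variables (I J : choiceType) (M : J -> grmod R) (N : I -> grmod R).

(** The image of [m] in the direct sum has no coordinate outside [j], so it can
    be a sum of elements of the other summands only if it is zero. *)
Lemma corner_eq0 (K : set J) j s (m : M j) :
  corner (dsum M) (gcod s) =
    isum K (fun j => dincl M j @` corner (M j) (gcod s)) ->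
  ~ K j -> grdeg (M j) s m -> m = 0.
Proof.
move=> MK Kj Ms.
suff: dproj M j (dincl M j m) = 0 by rewrite /= dfwith_in.
have := corner_homog (A := dsum M) (dinj_deg Ms).
by rewrite MK => /isum_dincl_out; apply=> // k _ [n _ <-]; exists n.
Qed.

Definition finitely_supported (A : homx M N) : Prop :=
  finite_set [set p : I * J | A p.1 p.2 != 0].

Lemma finitely_supportedD (A B : homx M N) :
  finitely_supported A -> finitely_supported B -> finitely_supported (A + B).
Proof.
move=> fA fB.
have : finite_set ([set p : I * J | A p.1 p.2 != 0] `|`
    [set p | B p.1 p.2 != 0]) by rewrite finite_setU.
apply: sub_finite_set => p /=.
apply: contra_neqP => /not_orP[/negP/negPn/eqP-> /negP/negPn/eqP->].
exact: addr0.
Qed.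

Lemma homx_deg_finitely_supported g (A : homx M N) (K : set J) :
  finite_set K ->
  corner (dsum M) (gdom g) =
    isum K (fun j => dincl M j @` corner (M j) (gdom g)) ->
  homx_deg g A -> finitely_supported A.
Proof.
move=> fK MK [fA Ag].
have : finite_set (\bigcup_(j in K)
    ((fun i => (i, j)) @` [set i | A i j != 0])).
  by apply: bigcup_finite => // j _; apply: finite_image; exact: fA.
apply: sub_finite_set => -[i j] /= Aij; exists j; last by exists i.
apply: contra_neqP Aij => Kj; apply: homdeg_eq0 (Ag i j) => s m sg.
by apply: corner_eq0 Kj; rewrite sg.
Qed.

End FiniteMatrices.

Theorem proposition3p10 (G : groupoid) (R : grring G) (I J : choiceType)
    (I_nonempty : [set: I] !=set0) (J_nonempty : [set: J] !=set0)
    (M : J -> grmod R) (N : I -> grmod R)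
    (finite_images_MN : finite_images M N) :
  [/\ exists F : HOM (dsum M) (dsum N) -> Hmx M N,
        gr_iso F /\
        forall f, gsval (F f) = natural_matrix (gsval f),
      finite_images M M ->
      exists F : END (dsum M) -> Hring M,
        gr_ring_iso F /\
        forall f, gsval (F f) = natural_matrix (gsval f)
    & (forall e : gobj G, exists2 K : set J, finite_set K &
        corner (dsum M) e = isum K (fun j => dincl M j @` corner (M j) e)) ->
      forall A : Hmx M N,
        finite_set [set p : I * J | mxfun (gsval A) p.1 p.2 != 0]].
Proof.
split; first exact: natural_matrix_iso.
  move=> fin; have [F [Fiso FE]] := natural_matrix_iso fin.
  exists F; split=> //; split=> // f f'; apply: gsval_inj.
  rewrite FE natural_matrix_comp -?FE //; exact: hmx_fin.
move=> MK A; move: (gsval A) (gsvalP A).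
apply: isum_ind => [||g B Bg].
- by apply: (sub_finite_set _ (finite_set0 _)) => p /=; rewrite eqxx.
- exact: finitely_supportedD.
- by have [K fK MKg] := MK (gdom g); exact: homx_deg_finitely_supported MKg Bg.
Qed.
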